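(* Let $\mathbb{F}$ be an algebraically closed field of characteristic $3$, and let $A_{1,3}(\alpha_1,\alpha_2,\alpha_4,\beta_1),\dots,A_{12,3}$ be the $2$-dimensional algebras over $\mathbb{F}$ given by the matrices of structure constants listed in the context. Then, for all values of the parameters $\alpha_1,\alpha_2,\alpha_4,\beta_1,\beta_2\in\mathbb{F}$ (subject to the restrictions indicated), the derivation algebras are: \begin{itemize} \item $Der(A_{1,3}(\alpha_1,\alpha_2,\alpha_4,\beta_1))=Der(A_{2,3}(\alpha_1,\beta_1,\beta_2))=Der(A_{3,3}(\beta_1,\beta_2))=\{0\}$; \item $Der(A_{4,3}(\alpha_1,\beta_2))=\left\{\begin{pmatrix}0&0\\0&d\end{pmatrix}: d\in\mathbb{F}\right\}$ if $\beta_2\neq 2\alpha_1-1$; \item $Der(A_{4,3}(\alpha_1,2\alpha_1-1))=\left\{\begin{pmatrix}0&0\\c&d\end{pmatrix}: c,d\in\mathbb{F}\right\}$; \item $Der(A_{5,3}(\alpha_1))=\left\{\begin{pmatrix}0&0\\c&0\end{pmatrix}: c\in\mathbb{F}\right\}$; \item $Der(A_{6,3}(\alpha_1,\beta_1))=Der(A_{7,3}(\beta_1))=\{0\}$; \item $Der(A_{8,3}(\alpha_1))=\left\{\begin{pmatrix}0&0\\0&d\end{pmatrix}: d\in\mathbb{F}\right\}$; \item $Der(A_{9,3})=\left\{\begin{pmatrix}0&2c\\c&0\end{pmatrix}: c\in\mathbb{F}\right\}$; \item $Der(A_{10,3})=\left\{\begin{pmatrix}a&b\\0&0\end{pmatrix}: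 a,b\in\mathbb{F}\right\}$; \item $Der(A_{11,3})=\left\{\begin{pmatrix}0&0\\c&0\end{pmatrix}: c\in\mathbb{F}\right\}$; \item $Der(A_{12,3})=\left\{\begin{pmatrix}a&0\\c&2a\end{pmatrix}: a,c\in\mathbb{F}\right\}$. \end{itemize}
   Context: An algebra over $\mathbb{F}$ is a vector space with a bilinear multiplication (no associativity, commutativity or unit is assumed). A $2$-dimensional algebra $\mathbb{A}$ with fixed basis $e=(e^1,e^2)$ is identified with its matrix of structure constants (MSC) $A=\begin{pmatrix}\alpha_1&\alpha_2&\alpha_3&\alpha_4\\ \beta_1&\beta_2&\beta_3&\beta_4\end{pmatrix}\in M(2\times 4;\mathbb{F})$, meaning $\mathbf{u}\cdot\mathbf{v}=eA(u\otimes v)$ for $\mathbf{u}=eu$, $\mathbf{v}=ev$ with coordinate column vectors $u,v$. Explicitly, $e^1e^1=\alpha_1e^1+\beta_1e^2$, $e^1e^2=\alpha_2e^1+\beta_2e^2$, $e^2e^1=\alpha_3e^1+\beta_3e^2$, $e^2e^2=\alpha_4e^1+\beta_4e^2$. A derivation is a linear map $\mathbf{d}$ with $\mathbf{d}(\mathbf{u}\cdot\mathbf{v})=\mathbf{d}(\mathbf{u})\cdot\mathbf{v}+\mathbf{u}\cdot\mathbf{d}(\mathbf{v})$; it is represented by the matrix $D\in M(2;\mathbb{F})$ with $\mathbf{d}(eu)=eDu$, so that $$Der(A)=\{D\in M(2;\mathbb{F}): A(D\otimes I+I\otimes D)-DA=0\},$$ where $I$ is the $2\times2$ identity matrix and,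 for matrices $X=(x_{ij})$ and $Y$, $X\otimes Y$ is the block matrix with blocks $(x_{ij}Y)$. The algebras are (all parameters are arbitrary elements of $\mathbb{F}$): $A_{1,3}(\alpha_1,\alpha_2,\alpha_4,\beta_1)=\begin{pmatrix}\alpha_1&\alpha_2&\alpha_2+1&\alpha_4\\ \beta_1&-\alpha_1&-\alpha_1+1&-\alpha_2\end{pmatrix}$; $A_{2,3}(\alpha_1,\beta_1,\beta_2)=\begin{pmatrix}\alpha_1&0&0&1\\ \beta_1&\beta_2&1-\alpha_1&0\end{pmatrix}$; $A_{3,3}(\beta_1,\beta_2)=\begin{pmatrix}0&1&1&0\\ \beta_1&\beta_2&1&-1\end{pmatrix}$; $A_{4,3}(\alpha_1,\beta_2)=\begin{pmatrix}\alpha_1&0&0&0\\ 0&\beta_2&1-\alpha_1&0\end{pmatrix}$; $A_{5,3}(\alpha_1)=\begin{pmatrix}\alpha_1&0&0&0\\ 1&-1-\alpha_1&1-\alpha_1&0\end{pmatrix}$; $A_{6,3}(\alpha_1,\beta_1)=\begin{pmatrix}\alpha_1&0&0&1\\ \beta_1&1-\alpha_1&-\alpha_1&0\end{pmatrix}$; $A_{7,3}(\beta_1)=\begin{pmatrix}0&1&1&0\\ \beta_1&1&0&-1\end{pmatrix}$; $A_{8,3}(\alpha_1)=\begin{pmatrix}\alpha_1&0&0&0\\ 0&1-\alpha_1&-\alpha_1&0\end{pmatrix}$; $A_{9,3}=\begin{pmatrix}0&1&1&0\\ 1&0&0&-1\end{pmatrix}$; $A_{10,3}=\begin{pmatrix}0&1&1&0\\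 0&0&0&-1\end{pmatrix}$; $A_{11,3}=\begin{pmatrix}1&0&0&0\\ 1&-1&-1&0\end{pmatrix}$; $A_{12,3}=\begin{pmatrix}0&0&0&0\\ 1&0&0&0\end{pmatrix}$. *)

(* Defs.v *)
From HB Require Import structures.
From mathcomp Require Import all_boot all_order all_algebra.
From mathcomp Require Import classical_sets.
From mathcomp.real_closed Require Import mxtens.

Set Implicit Arguments.
Unset Strict Implicit.
Unset Printing Implicit Defensive.

Import GRing.Theory.
Local Open Scope classical_set_scope.
Local Open Scope ring_scope.

(* [A *t B] is the Kronecker product (A i j *: B)_(i, j).  Columns of an MSC are
   indexed by 'I_(2 * 2), the pair (j, k) having index 2 * j + k, which is the
   order e^1e^1, e^1e^2, e^2e^1, e^2e^2. *)
Notation msc F := 'M[F]_(2, 2 * 2).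

Section Derivations.
Variable F : fieldType.
Implicit Types (A : msc F) (D : 'M[F]_2) (u v : 'cV[F]_2).

Definition mx_of_rows m n (s : seq (seq F)) : 'M[F]_(m, n) :=
  \matrix_(i < m, j < n) (nth [::] s i)`_j.

Definition mk_mx2 (a b c d : F) : 'M[F]_2 :=
  mx_of_rows 2 2 [:: [:: a; b]; [:: c; d]].

Definition mk_msc (a1 a2 a3 a4 b1 b2 b3 b4 : F) : msc F :=
  mx_of_rows 2 (2 * 2) [:: [:: a1; a2; a3; a4]; [:: b1; b2; b3; b4]].

Definition msc_mul A u v : 'cV[F]_2 := A *m (u *t v).

Definition Der A : set 'M[F]_2 :=
  [set D | A *m (D *t 1%:M + 1%:M *t D) - D *m A = 0].

Lemma msc_mul_delta A (j k : 'I_2) :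
  msc_mul A (delta_mx j 0) (delta_mx k 0) = col (mxtens_index (j, k)) A.
Proof.
rewrite colE /msc_mul; congr (_ *m _); apply/matrixP=> i l.
case: (mxtens_indexP i) => i1 i2; rewrite !mxE !mxtens_indexK /= !ord1 !eqxx.
rewrite !andbT -natrM mulnb; congr (_%:R); congr nat_of_bool.
by rewrite (can_eq (@mxtens_indexK _ _)) xpair_eqE.
Qed.

Lemma DerP A D :
  Der A D <-> forall u v,
    D *m msc_mul A u v = msc_mul A (D *m u) v + msc_mul A u (D *m v).
Proof.
have E u v : A *m (D *t 1%:M + 1%:M *t D) *m (u *t v)
    = msc_mul A (D *m u) v + msc_mul A u (D *m v).
  by rewrite -mulmxA mulmxDl !tensmx_mul !mul1mx mulmxDr.
split=> [/eqP|H].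
  rewrite subr_eq0 => /eqP H u v.
  by rewrite -E H /msc_mul mulmxA.
apply/eqP; rewrite subr_eq0; apply/eqP/matrixP => i k.
case: (mxtens_indexP k) => k1 k2.
have := H (delta_mx k1 0) (delta_mx k2 0); rewrite -E msc_mul_delta.
rewrite -/(msc_mul (A *m _) _ _) msc_mul_delta !colE mulmxA -!colE.
by move=> /matrixP/(_ i 0); rewrite !mxE => ->.
Qed.

Definition A1_3 (a1 a2 a4 b1 : F) : msc F :=
  mk_msc a1   a2     (a2 + 1)     a4
         b1 (- a1) (- a1 + 1) (- a2).

Definition A2_3 (a1 b1 b2 : F) : msc F :=
  mk_msc a1  0     0    1
         b1 b2 (1 - a1) 0.

Definition A3_3 (b1 b2 : F) : msc F :=
  mk_msc  0  1 1    0
         b1 b2 1 (- 1).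

Definition A4_3 (a1 b2 : F) : msc F :=
  mk_msc a1  0     0    0
          0 b2 (1 - a1) 0.

Definition A5_3 (a1 : F) : msc F :=
  mk_msc a1     0         0    0
          1 (- 1 - a1) (1 - a1) 0.

Definition A6_3 (a1 b1 : F) : msc F :=
  mk_msc a1     0       0   1
         b1 (1 - a1) (- a1) 0.

Definition A7_3 (b1 : F) : msc F :=
  mk_msc  0 1 1    0
         b1 1 0 (- 1).

Definition A8_3 (a1 : F) : msc F :=
  mk_msc a1     0       0   0
          0 (1 - a1) (- a1) 0.

Definition A9_3 : msc F :=
  mk_msc 0 1 1    0
         1 0 0 (- 1).

Definition A10_3 : msc F :=
  mk_msc 0 1 1    0
         0 0 0 (- 1).

Definition A11_3 : msc F :=
  mk_msc 1    0     0   0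
         1 (- 1) (- 1) 0.

Definition A12_3 : msc F :=
  mk_msc 0 0 0 0
         1 0 0 0.

End Derivations.

Arguments A9_3 {F}.
Arguments A10_3 {F}.
Arguments A11_3 {F}.
Arguments A12_3 {F}.

(* Main.v *)
Require Import Defs.
From mathcomp Require Import all_boot all_order all_algebra.
From mathcomp Require Import classical_sets.
From mathcomp Require Import ring.
From mathcomp.real_closed Require Import mxtens.

Import GRing.Theory.
Local Open Scope classical_set_scope.
Local Open Scope ring_scope.

(** A derivation is determined by the Leibniz rule on the four products
    [e^j e^k] of basis vectors.  For an unknown matrix [x, y; z, w] this gives
    eight linear equations in [x, y, z, w] whose coefficients come from the
    structure constants ([mem_Der_mk]), and each derivation algebra is the
    solution space of such a system.

    In every family the system contains short equations that isolate the
    unknowns one after the other: usually the sum or difference of two of them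
    has the structure parameters cancel out and leaves an unknown, its opposite,
    or twice an unknown.  Each elimination step is thus an explicit linear
    combination of at most two equations ([eq_lincomb]).

    Characteristic 3 enters in two ways.  It makes [2 = -1] invertible, so that
    [2 * t = 0] kills an unknown [t].  And it erases multiples of 3: this is why
    [w] does not depend on [z] for [A5_3] and [A11_3], where the product
    [e^1 e^1] imposes [w = - (3 * a1) * z] and [w = - 3 * z] once [x = 0]; why
    [z = 0] for [A8_3], where the same product imposes [(3 * a1 - 1) * z = 0];
    and why [y] may be nonzero for [A9_3] and [A10_3], where the product
    [e^2 e^2] imposes [- y = 2 * y]. *)

(** * Linear combinations of equations *)

(** This turns one step of linear elimination into a certificate: the two
    coefficients are given, and what is left is a polynomial identity. *)
Lemma eq_lincomb (R : pzRingType) (a b c d c' d' : R)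
    (e : c = d) (e' : c' = d') (k l : R) :
  a - b = k * (c - d) + l * (c' - d') -> a = b.
Proof. by rewrite e e' !subrr !mulr0 addr0 => /subr0_eq. Qed.

Tactic Notation "lincomb" uconstr(k) constr(e) uconstr(l) constr(e') :=
  refine (eq_lincomb _ _ _ _ _ _ _ e e' k l _); ring.
Tactic Notation "lincomb" uconstr(k) constr(e) := lincomb k e 0 e.

(** * Derivations in coordinates *)

Lemma mk_mx2_eta (F : fieldType) (D : 'M[F]_2) :
  D = mk_mx2 (D 0 0) (D 0 1) (D 1 0) (D 1 1).
Proof.
apply/matrixP=> i j; rewrite mxE.
by case: i => [[|[|//]]] Hi; case: j => [[|[|//]]] Hj /=;
  congr (D _ _); apply: val_inj.
Qed.

Lemma mk_mx2_0 (F : fieldType) : mk_mx2 0 0 0 0 = 0 :> 'M[F]_2.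
Proof. by rewrite [RHS]mk_mx2_eta !mxE. Qed.

Lemma sum_mxtens_index (V : nmodType) (m n : nat) (f : 'I_(m * n) -> V) :
  \sum_l f l = \sum_p \sum_q f (mxtens_index (p, q)).
Proof.
rewrite pair_bigA /= (reindex (@mxtens_index m n)) /=.
  by apply: eq_bigr => [[p q] _].
exact/onW_bij/(Bijective (@mxtens_indexK m n) (@mxtens_unindexK m n)).
Qed.

(** This is the Leibniz rule for the product of the [j]-th and [k]-th basis
    vectors, read off coordinate by coordinate. *)
Lemma mem_Der_entries (F : fieldType) (A : msc F) (D : 'M[F]_2) :
  Der A D <-> forall i j k : 'I_2,
    \sum_p D i p * A p (mxtens_index (j, k)) =
    \sum_p A i (mxtens_index (p, k)) * D p j +
    \sum_p A i (mxtens_index (j, p)) * D p k.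
Proof.
have tensE (i j k : 'I_2) :
    (A *m (D *t 1%:M + 1%:M *t D)) i (mxtens_index (j, k)) =
    \sum_p A i (mxtens_index (p, k)) * D p j +
    \sum_p A i (mxtens_index (j, p)) * D p k.
  rewrite mulmxDr !mxE !sum_mxtens_index; congr (_ + _).
    apply: eq_bigr => p _; rewrite (bigD1 k) //= big1 ?addr0 => [|q neq_qk].
      by rewrite tensmxE mxE eqxx mulr1.
    by rewrite tensmxE mxE (negPf neq_qk) !mulr0.
  rewrite (bigD1 j) //= [X in _ + X]big1 ?addr0 => [|p neq_pj].
    by apply: eq_bigr => q _; rewrite tensmxE mxE eqxx mul1r.
  by apply: big1 => q _; rewrite tensmxE mxE (negPf neq_pj) mul0r mulr0.
split=> [/subr0_eq eqAD i j k | eqAD]; first by rewrite -tensE eqAD mxE.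
apply/eqP; rewrite subr_eq0; apply/eqP/matrixP=> i jk.
by case: (mxtens_indexP jk) => j k; rewrite tensE -eqAD mxE.
Qed.

(** The four conjunctions belong to the products [e^1 e^1], [e^1 e^2],
    [e^2 e^1], [e^2 e^2] in this order; in each, the first equation compares the
    coefficients of [e^1] and the second those of [e^2].  Below they are called
    [pjk] and [qjk] for the product of [e^j] and [e^k]. *)
Lemma mem_Der_mk (F : fieldType)
    (a1 a2 a3 a4 b1 b2 b3 b4 x y z w : F) :
  Der (mk_msc a1 a2 a3 a4 b1 b2 b3 b4) (mk_mx2 x y z w) <->
  [/\ a1 * x + b1 * y = 2 * a1 * x + (a2 + a3) * z /\
      a1 * z + b1 * w = 2 * b1 * x + (b2 + b3) * z,
      a2 * x + b2 * y = a1 * y + a2 * (x + w) + a4 * z /\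
      a2 * z + b2 * w = b1 * y + b2 * (x + w) + b4 * z,
      a3 * x + b3 * y = a1 * y + a3 * (x + w) + a4 * z /\
      a3 * z + b3 * w = b1 * y + b3 * (x + w) + b4 * z
    & a4 * x + b4 * y = (a2 + a3) * y + 2 * a4 * w /\
      a4 * z + b4 * w = (b2 + b3) * y + 2 * b4 * w].
Proof.
rewrite mem_Der_entries.
split=> [eqD | [[p11 q11] [p12 q12] [p21 q21] [p22 q22]]].
  split; split; [have := eqD 0 0 0 | have := eqD 1 0 0 | have := eqD 0 0 1
    | have := eqD 1 0 1 | have := eqD 0 1 0 | have := eqD 1 1 0
    | have := eqD 0 1 1 | have := eqD 1 1 1];
  rewrite !big_ord_recl !big_ord0 !mxE /= !addr0 => e; lincomb 1 e.
case=> [[|[|//]]] Hi; case=> [[|[|//]]] Hj; case=> [[|[|//]]] Hk;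
  rewrite !big_ord_recl !big_ord0 !mxE /= !addr0;
  [ lincomb 1 p11 | lincomb 1 p12 | lincomb 1 p21 | lincomb 1 p22
  | lincomb 1 q11 | lincomb 1 q12 | lincomb 1 q21 | lincomb 1 q22 ].
Qed.

Lemma Der_eq (F : fieldType) (A : msc F) (S : set 'M[F]_2) :
  (forall x y z w, Der A (mk_mx2 x y z w) -> S (mk_mx2 x y z w)) ->
  S `<=` Der A -> Der A = S.
Proof.
move=> DS SD; apply/seteqP; split=> // D.
by rewrite [D]mk_mx2_eta; apply: DS.
Qed.

Lemma Der_eq0 (F : fieldType) (A : msc F) :
  (forall x y z w, Der A (mk_mx2 x y z w) ->
    [/\ x = 0, y = 0, z = 0 & w = 0]) ->
  Der A = [set 0].
Proof.
move=> D0; apply: Der_eq => [x y z w /D0[-> -> -> ->]|_ ->].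
  by rewrite /= mk_mx2_0.
rewrite -mk_mx2_0 mem_Der_entries => i j k.
by rewrite mk_mx2_0 !big1 ?addr0 // => p _;
  rewrite mxE ?mul0r ?mulr0.
Qed.

(** * The twelve algebras *)

Lemma Der_A1_3 (F : fieldType) (a1 a2 a4 b1 : F) :
  Der (A1_3 a1 a2 a4 b1) = [set 0].
Proof.
apply: Der_eq0 => x y z w /mem_Der_mk[[p11 _] [p12 q12] [p21 q21] [_ q22]].
have wy : w = y by lincomb (-1) p21 1 p12.
have zx : z = x by lincomb 1 q21 (-1) q12.
subst w z.
have x0 : x = 0 by lincomb (-1) p11 (-1) q12.
subst x.
have y0 : y = 0 by lincomb (-1) p12 (-1) q22.
by subst y.
Qed.

Lemma Der_A2_3 (F : fieldType) (three0 : 3 = 0 :> F) (a1 b1 b2 : F) :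
  Der (A2_3 a1 b1 b2) = [set 0].
Proof.
apply: Der_eq0 => x y z w /mem_Der_mk[[p11 _] [p12 _] [_ q21] [p22 q22]].
have x0 : x = 0 by lincomb (-1) p11 (-1) q21.
subst x.
have w0 : w = 0 by lincomb w three0 1 p22.
have y0 : y = 0 by lincomb (-1) p12 (-1) q22.
subst y.
have z0 : z = 0 by lincomb 1 q22.
by [].
Qed.

Lemma Der_A3_3 (F : fieldType) (three0 : 3 = 0 :> F) (b1 b2 : F) :
  Der (A3_3 b1 b2) = [set 0].
Proof.
apply: Der_eq0 => x y z w /mem_Der_mk[[p11 _] [p12 _] [p21 q21] [_ q22]].
have x0 : x = 0 by lincomb (-1) p11 (-1) q21.
have y0 : y = 0 by lincomb (-1) p12 (-1) q22.
subst x y.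
have w0 : w = 0 by lincomb (-1) p21.
have z0 : z = 0 by lincomb z three0 1 p11.
by [].
Qed.

(** The generic and the special case of [A4_3] differ only in whether the
    equation for the [e^2]-coefficient of [e^1 e^1] forces [z = 0]. *)
Lemma mem_Der_A4_3 (F : fieldType) (a1 b2 x y z w : F) :
  Der (A4_3 a1 b2) (mk_mx2 x y z w) <->
  [/\ x = 0, y = 0 & (b2 - (2 * a1 - 1)) * z = 0].
Proof.
rewrite mem_Der_mk; split=> [[[p11 q11] [p12 _] [_ q21] [_ q22]]|[-> -> e]].
  split; first by lincomb (-1) p11 (-1) q21.
    by lincomb (-1) p12 (-1) q22.
  by lincomb (-1) q11.
split; split; try ring.
by lincomb (-1) e.
Qed.

Lemma Der_A4_3_generic (F : fieldType) (a1 b2 : F) : b2 <> 2 * a1 - 1 ->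
  Der (A4_3 a1 b2) = [set D | exists d : F, D = mk_mx2 0 0 0 d].
Proof.
move=> b2P; apply: Der_eq => [x y z w /mem_Der_A4_3[-> -> /eqP]|_ [d ->]].
  rewrite mulf_eq0 subr_eq0 => /orP[/eqP //|/eqP ->].
  by exists w.
by apply/mem_Der_A4_3; rewrite mulr0.
Qed.

Lemma Der_A4_3_special (F : fieldType) (a1 : F) :
  Der (A4_3 a1 (2 * a1 - 1)) = [set D | exists c d : F, D = mk_mx2 0 0 c d].
Proof.
apply: Der_eq => [x y z w /mem_Der_A4_3[-> -> _]|_ [c [d ->]]].
  by exists z, w.
by apply/mem_Der_A4_3; rewrite subrr mul0r.
Qed.

Lemma Der_A5_3 (F : fieldType) (three0 : 3 = 0 :> F) (a1 : F) :
  Der (A5_3 a1) = [set D | exists c : F, D = mk_mx2 0 0 c 0].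
Proof.
apply: Der_eq => [x y z w|_ [c ->]].
  move=> /mem_Der_mk[[p11 q11] [p12 _] [p21 q21] _].
  have y0 : y = 0.
    have y20 : 2 * y = 0 by lincomb 1 p21 (-1) p12.
    by lincomb y three0 (-1) y20.
  subst y.
  have x0 : x = 0 by lincomb (-1) p11 (-1) q21.
  subst x.
  have w0 : w = 0 by lincomb 1 q11 (- (a1 * z)) three0.
  by subst w; exists z.
apply/mem_Der_mk; split; split; try ring.
by lincomb (a1 * c) three0.
Qed.

Lemma Der_A6_3 (F : fieldType) (three0 : 3 = 0 :> F) (a1 b1 : F) :
  Der (A6_3 a1 b1) = [set 0].
Proof.
apply: Der_eq0 => x y z w /mem_Der_mk[_ [p12 q12] [p21 q21] [p22 q22]].
have y0 : y = 0 by lincomb 1 p12 (-1) p21.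
have x0 : x = 0 by lincomb (-1) q12 1 q21.
subst x y.
have w0 : w = 0 by lincomb w three0 1 p22.
have z0 : z = 0 by lincomb 1 q22.
by [].
Qed.

Lemma Der_A7_3 (F : fieldType) (three0 : 3 = 0 :> F) (b1 : F) :
  Der (A7_3 b1) = [set 0].
Proof.
apply: Der_eq0 => x y z w /mem_Der_mk[_ [p12 q12] [p21 q21] _].
have w0 : w = 0 by lincomb (-1) p21.
have y0 : y = 0 by lincomb 1 p12 (-1) p21.
have x0 : x = 0 by lincomb (-1) q12 1 q21.
subst x y.
have z0 : z = 0 by lincomb z three0 (-1) q21.
by [].
Qed.

Lemma Der_A8_3 (F : fieldType) (three0 : 3 = 0 :> F) (a1 : F) :
  Der (A8_3 a1) = [set D | exists d : F, D = mk_mx2 0 0 0 d].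
Proof.
apply: Der_eq => [x y z w|_ [d ->]].
  move=> /mem_Der_mk[[_ q11] [p12 q12] [p21 q21] _].
  have y0 : y = 0 by lincomb 1 p12 (-1) p21.
  have x0 : x = 0 by lincomb (-1) q12 1 q21.
  have z0 : z = 0 by lincomb (a1 * z) three0 (-1) q11.
  by subst x y z; exists w.
by apply/mem_Der_mk; split; split; ring.
Qed.

Lemma Der_A9_3 (F : fieldType) (three0 : 3 = 0 :> F) :
  Der A9_3 = [set D | exists c : F, D = mk_mx2 0 (2 * c) c 0].
Proof.
apply: Der_eq => [x y z w|_ [c ->]].
  move=> /mem_Der_mk[[p11 q11] [p12 _] _ _].
  have w0 : w = 0 by lincomb (-1) p12.
  subst w.
  have x0 : x = 0 by lincomb x three0 1 q11.
  have y2z : y = 2 * z by lincomb 1 p11.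
  by subst x y; exists z.
apply/mem_Der_mk; split; split; try ring.
by lincomb (- (2 * c)) three0.
Qed.

Lemma Der_A10_3 (F : fieldType) (three0 : 3 = 0 :> F) :
  Der A10_3 = [set D | exists a b : F, D = mk_mx2 a b 0 0].
Proof.
apply: Der_eq => [x y z w|_ [a [b ->]]].
  move=> /mem_Der_mk[[p11 _] [p12 _] _ _].
  have w0 : w = 0 by lincomb (-1) p12.
  have z0 : z = 0 by lincomb z three0 1 p11.
  by subst w z; exists x, y.
apply/mem_Der_mk; split; split; try ring.
by lincomb (- b) three0.
Qed.

Lemma Der_A11_3 (F : fieldType) (three0 : 3 = 0 :> F) :
  Der A11_3 = [set D | exists c : F, D = mk_mx2 0 0 c 0].
Proof.
apply: Der_eq => [x y z w|_ [c ->]].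
  move=> /mem_Der_mk[[p11 q11] [p12 _] _ _].
  have y0 : y = 0 by lincomb y three0 1 p12.
  subst y.
  have x0 : x = 0 by lincomb (-1) p11.
  subst x.
  have w0 : w = 0 by lincomb 1 q11 (- z) three0.
  by subst w; exists z.
apply/mem_Der_mk; split; split; try ring.
by lincomb c three0.
Qed.

Lemma Der_A12_3 (F : fieldType) :
  Der A12_3 = [set D | exists a c : F, D = mk_mx2 a 0 c (2 * a)].
Proof.
apply: Der_eq => [x y z w|_ [a [c ->]]].
  move=> /mem_Der_mk[[p11 q11] _ _ _].
  have y0 : y = 0 by lincomb 1 p11.
  have w2x : w = 2 * x by lincomb 1 q11.
  by subst y w; exists x, z.
by apply/mem_Der_mk; split; split; ring.
Qed.

Theorem theorem4p3 (F : closedFieldType) (char3 : 3%N \in [pchar F]) :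
  (forall a1 a2 a4 b1 : F, Der (A1_3 a1 a2 a4 b1) = [set 0]) /\
  (forall a1 b1 b2 : F, Der (A2_3 a1 b1 b2) = [set 0]) /\
  (forall b1 b2 : F, Der (A3_3 b1 b2) = [set 0]) /\
  (forall a1 b2 : F, b2 <> 2 * a1 - 1 ->
     Der (A4_3 a1 b2) = [set D | exists d : F, D = mk_mx2 0 0 0 d]) /\
  (forall a1 : F,
     Der (A4_3 a1 (2 * a1 - 1)) =
       [set D | exists c d : F, D = mk_mx2 0 0 c d]) /\
  (forall a1 : F,
     Der (A5_3 a1) = [set D | exists c : F, D = mk_mx2 0 0 c 0]) /\
  (forall a1 b1 : F, Der (A6_3 a1 b1) = [set 0]) /\
  (forall b1 : F, Der (A7_3 b1) = [set 0]) /\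
  (forall a1 : F,
     Der (A8_3 a1) = [set D | exists d : F, D = mk_mx2 0 0 0 d]) /\
  Der A9_3 = [set D | exists c : F, D = mk_mx2 0 (2 * c) c 0] /\
  Der A10_3 = [set D | exists a b : F, D = mk_mx2 a b 0 0] /\
  Der A11_3 = [set D | exists c : F, D = mk_mx2 0 0 c 0] /\
  Der A12_3 = [set D | exists a c : F, D = mk_mx2 a 0 c (2 * a)].
Proof.
have three0 : 3 = 0 :> F := pcharf0 char3.
split; first exact: Der_A1_3.
split; first exact: Der_A2_3.
split; first exact: Der_A3_3.
split; first exact: Der_A4_3_generic.
split; first exact: Der_A4_3_special.
split; first exact: Der_A5_3.
split; first exact: Der_A6_3.
split; first exact: Der_A7_3.
split; first exact: Der_A8_3.
split; first exact: Der_A9_3.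
split; first exact: Der_A10_3.
split; first exact: Der_A11_3.
exact: Der_A12_3.
Qed.
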